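(* Let $k,m$ be positive integers such that Hadamard matrices of orders $k$ and $m$ exist. Then there exists a balancedly splittable Hadamard matrix of order $km$ with parameters $(km,k(m-1),0,-k)$.
   Context: A Hadamard matrix of order $n$ is an $n\times n$ $\{1,-1\}$-matrix $H$ with $HH^\top=nI_n$; $J_n$ is the all-ones matrix. $H$ is balancedly splittable with parameters $(n,\ell,a,b)$ if, after permuting its rows, $H=\begin{pmatrix}H_1\\H_2\end{pmatrix}$ with $H_1$ an $\ell\times n$ matrix such that $H_1^\top H_1=\ell I_n+aA+b(J_n-A-I_n)$ for a symmetric $(0,1)$-matrix $A$ with zero diagonal. *)

(* Defs.v *)
From mathcomp Require Import all_boot all_order all_fingroup all_algebra.

Set Implicit Arguments.
Unset Strict Implicit.
Unset Printing Implicit Defensive.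

Import GRing.Theory.
Local Open Scope ring_scope.

Definition hadamard (n : nat) (H : 'M[int]_n) : Prop :=
  (forall i j, H i j = 1 \/ H i j = -1) /\ H *m H^T = (n%:Z)%:M.

Definition symmetric01_zero_diag (n : nat) (A : 'M[int]_n) : Prop :=
  [/\ A^T = A,
      forall i j, A i j = 0 \/ A i j = 1
    & forall i, A i i = 0].

(* The cast along [n = l + r] only lets the row-permuted H be written as a
   block column; either block may be empty. *)
Definition balancedly_splittable (n l : nat) (a b : int) (H : 'M[int]_n)
    : Prop :=
  exists (r : nat) (e : n = (l + r)%N) (s : 'S_n)
         (H1 : 'M[int]_(l, n)) (H2 : 'M[int]_(r, n)),
    castmx (e, erefl n) (row_perm s H) = col_mx H1 H2 /\
    exists A : 'M[int]_n,
      symmetric01_zero_diag A /\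
      H1^T *m H1 = (l%:Z)%:M + a *: A + b *: (const_mx 1 - A - 1%:M).

(* Main.v *)
Require Import Defs.
From mathcomp Require Import all_boot all_order all_fingroup all_algebra.
From mathcomp Require Import mxtens.

Set Implicit Arguments.
Unset Strict Implicit.
Unset Printing Implicit Defensive.

Import GRing.Theory.
Local Open Scope ring_scope.

(** Scale the columns of the matrix of order m so that its last row is all
    ones, leaving M' above it, and take the Kronecker product with the matrix
    K of order k.  The Gram matrix of the rows M' ⊗ K is
    (m I - J) ⊗ k I = k (m - 1) I - k (J ⊗ I - I), so A = J - J ⊗ I works. *)

(** Over a domain such as [int], [A] need not be invertible. Still [\det A] divides [c ^+ n], hence
    is nonzero; multiplying [A *m (B *m A - c%:M) = 0] by the adjugate lets it be cancelled
    entrywise. *)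
Lemma mulmx_scalar_comm (R : idomainType) (n : nat) (A B : 'M[R]_n) (c : R) :
  c != 0 -> A *m B = c%:M -> B *m A = c%:M.
Proof.
move=> c0 AB; have dA : \det A != 0.
  apply: contraNneq (expf_neq0 n c0) => dA0.
  by rewrite -(det_scalar n c) -AB det_mulmx dA0 mul0r.
have A0 : A *m (B *m A - c%:M) = 0.
  by rewrite mulmxBr mulmxA AB mul_scalar_mx mul_mx_scalar subrr.
have /matrixP d0 : \det A *: (B *m A - c%:M) = 0.
  by rewrite -mul_scalar_mx -mul_adj_mx -mulmxA A0 mulmx0.
apply/subr0_eq/matrixP => i j; apply: (mulfI dA).
by have := d0 i j; rewrite mxE => ->; rewrite !mxE mulr0.
Qed.

Lemma tensmx_scalar (R : pzRingType) (m n : nat) (a b : R) :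
  a%:M *t b%:M = (a * b)%:M :> 'M_(m * n).
Proof.
apply/matrixP => i j.
case: (mxtens_indexP i) => i1 i2; case: (mxtens_indexP j) => j1 j2.
rewrite tensmxE !mxE (can_eq (@mxtens_indexK m n)) xpair_eqE.
by case: eqP => _; case: eqP => _ /=; rewrite ?mulr0n ?mulr1n ?mulr0 ?mul0r.
Qed.

(** The pair [(i1, i2)] is encoded as [i1 * p + i2], so the rows coming from [A] precede those
    coming from [B], and the cast keeps index values. *)
Lemma castmx_tens_col_mx (R : pzRingType) (m1 m2 n p q : nat)
    (A : 'M[R]_(m1, n)) (B : 'M[R]_(m2, n)) (C : 'M[R]_(p, q)) :
  castmx (mulnDl m1 m2 p, erefl _) (col_mx A B *t C)
  = col_mx (A *t C) (B *t C).
Proof.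
apply/matrixP => i j; rewrite castmxE cast_ord_id.
case: (mxtens_indexP j) => j1 j2.
have [i' ->] : exists i', i = unsplit i' by exists (split i); rewrite splitK.
case: i' => i' /=; case: (mxtens_indexP i') => i1 i2.
  rewrite col_mxEu tensmxE -(col_mxEu A B) -tensmxE; congr (tensmx _ _ _ _).
  exact: val_inj.
rewrite col_mxEd tensmxE -(col_mxEd A B) -tensmxE; congr (tensmx _ _ _ _).
by apply: val_inj; rewrite /= mulnDl addnA.
Qed.

Lemma sign_mul (x y : int) :
  x = 1 \/ x = -1 -> y = 1 \/ y = -1 -> x * y = 1 \/ x * y = -1.
Proof. by move=> [] -> [] ->; [left|right|right|left]. Qed.

Lemma hadamard_tens (m k : nat) (M : 'M[int]_m) (K : 'M[int]_k) :
  hadamard M -> hadamard K -> hadamard (M *t K).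
Proof.
move=> [sM MM] [sK KK]; split=> [i j|].
  by rewrite mxE; apply: sign_mul.
by rewrite trmx_tens tensmx_mul MM KK tensmx_scalar PoszM.
Qed.

(** Passes from orthogonal rows to orthogonal columns, since splittability concerns column Gram
    matrices. *)
Lemma hadamard_trmx_mul (n : nat) (H : 'M[int]_n) :
  (0 < n)%N -> hadamard H -> H^T *m H = (n%:Z)%:M.
Proof.
by move=> n0 [_ HH]; apply: mulmx_scalar_comm HH; rewrite eqz_nat -lt0n.
Qed.

Lemma hadamard_scale_cols (n : nat) (H : 'M[int]_n) (d : 'rV[int]_n) :
  (forall j, d 0 j = 1 \/ d 0 j = -1) -> hadamard H ->
  hadamard (H *m diag_mx d).
Proof.
move=> sd [sH HH]; split=> [i j|].
  by rewrite mul_mx_diag mxE; apply: sign_mul.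
have dd : diag_mx d *m diag_mx d = 1%:M.
  rewrite mulmx_diag -diag_const_mx; congr diag_mx.
  by apply/rowP => j; rewrite !mxE; case: (sd j) => ->.
by rewrite trmx_mul tr_diag_mx mulmxA -(mulmxA H) dd mulmx1.
Qed.

(** Each column is multiplied by its own last entry, a sign, whose square is 1. *)
Lemma hadamard_last_row_ones (m : nat) (M : 'M[int]_(m + 1)) :
  hadamard M -> exists M1, hadamard (col_mx M1 (const_mx 1) : 'M_(m + 1)).
Proof.
move=> hM; pose i0 : 'I_(m + 1) := rshift m ord0.
have sd j : row i0 M 0 j = 1 \/ row i0 M 0 j = -1 by rewrite mxE; apply: hM.1.
have hH := hadamard_scale_cols sd hM; exists (usubmx (M *m diag_mx (row i0 M))).
suff <- : dsubmx (M *m diag_mx (row i0 M)) = const_mx 1 by rewrite vsubmxK.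
apply/matrixP => i j; rewrite mxE mul_mx_diag !mxE ord1 -/i0.
by case: (hM.1 i0 j) => ->.
Qed.

Lemma symmetric01_zero_diag_blocks (m k : nat) :
  symmetric01_zero_diag
    (const_mx 1 - const_mx 1 *t 1%:M : 'M[int]_(m * k)).
Proof.
split=> [|i j|i].
- by rewrite linearB /= trmx_const trmx_tens trmx_const trmx1.
- by rewrite !mxE mul1r; case: eqP => _; [left|right].
- by rewrite !mxE eqxx.
Qed.

Lemma tens_balancedly_splittable (m k : nat) (M1 : 'M[int]_(m, m + 1))
    (K : 'M[int]_k) :
  (0 < k)%N -> hadamard (col_mx M1 (const_mx 1) : 'M_(m + 1)) -> hadamard K ->
  balancedly_splittable (m * k) 0 (- k%:Z)
    (col_mx M1 (const_mx 1) *t K : 'M_((m + 1) * k)).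
Proof.
move=> k0 hM hK; exists (1 * k)%N, (mulnDl m 1 k), 1%g, (M1 *t K).
exists (const_mx 1 *t K); split; first by rewrite row_perm1 castmx_tens_col_mx.
exists (const_mx 1 - const_mx 1 *t 1%:M).
split; first exact: symmetric01_zero_diag_blocks.
(* The deleted row of ones contributes exactly the all-ones matrix to the full column Gram
   matrix. *)
have M1M1 : M1^T *m M1 = ((m + 1)%N%:Z)%:M - const_mx 1.
  have m1 : (0 < m + 1)%N by rewrite addn1.
  rewrite -(hadamard_trmx_mul m1 hM) tr_col_mx mul_row_col.
  rewrite [X in _ + X - _](_ : _ = const_mx 1) ?addrK //.
  by apply/matrixP => i j; rewrite !mxE big_ord1 !mxE.
rewrite trmx_tens tensmx_mul M1M1 hadamard_trmx_mul //.
apply/matrixP => i j.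
case: (mxtens_indexP i) => i1 i2; case: (mxtens_indexP j) => j1 j2.
rewrite tensmxE !mxE !mxtens_indexK (can_eq (@mxtens_indexK _ _)) xpair_eqE /=.
rewrite mul0r addr0 PoszD PoszM mul1r.
(* The common entry is [m * k] on the diagonal, [- k] when only the outer indices differ, and 0
   whenever the inner ones differ. *)
case: (i1 == j1); case: (i2 == j2) => /=; rewrite ?mulr0n ?mulr1n.
- by rewrite addrK subr0 subrr mulr0 addr0.
- by rewrite mulr0 !subr0 subrr mulr0 addr0.
- by rewrite sub0r mulN1r subrr !subr0 add0r mulr1.
- by rewrite mulr0 !subr0 subrr mulr0 addr0.
Qed.

Theorem theorem3p3 (k m : nat) (hk : (0 < k)%N) (hm : (0 < m)%N)
    (hadk : exists K : 'M[int]_k, hadamard K)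
    (hadm : exists M : 'M[int]_m, hadamard M) :
  exists H : 'M[int]_(k * m),
    hadamard H /\
    balancedly_splittable (k * (m - 1)) 0 (- k%:Z) H.
Proof.
case: hadk => K hK; case: m hm hadm => // m _; rewrite -addn1 => -[M hM].
(* Now [m] is the original order minus one; the products are swapped because the factor of order [k]
   comes second. *)
rewrite addnK !(mulnC k); have [M1 hM1] := hadamard_last_row_ones hM.
exists (col_mx M1 (const_mx 1) *t K).
by split; [apply: hadamard_tens | apply: tens_balancedly_splittable].
Qed.
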